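(* Let $n,d\ge 1$ be integers, let $\bar\gamma=(\gamma_1,\dots,\gamma_n)$ where each $\gamma_i$ is a directional function on $\mathbb{S}^{d-1}$, and let $A=[a_{ij}]\in\mathbb{R}^{n\times n}$ be a nonnegative weight matrix for a strongly connected directed graph $\mathcal{G}(n)$ on the nodes $\{1,\dots,n\}$, satisfying $$a_{ii}\min_{x\in\mathbb{S}^{d-1}}\gamma_i(x)>\sum_{j\ne i}a_{ij}\max_{x\in\mathbb{S}^{d-1}}\gamma_j(x)\qquad\forall i\in\{1,\dots,n\}.$$ Let $t_0\ge 0$ be an integer, let $X_0\in\mathbb{S}(n,d,\bar\gamma)$, and let $X(t)$, $t\ge t_0$, be given by $X(t_0)=X_0$ and $X(t+1)=P_{\mathbb{S}(n,d,\bar\gamma)}(AX(t))$, with $x_i(t)=[X(t)]_i$. Let $v(X_0)\in\mathbb{S}^{n-1}$ be the vector defined in the context. Under each one of the following conditions, $v(X_0)X_0\ne\mathbf{0}_{1,d}$, and hence there is asymptotic consensus of directions with point-wise convergence (there is $u\in\mathbb{S}^{d-1}$ with $\frac{x_i(t)}{\|x_i(t)\|_2}\to u$ as $t\to\infty$ for all $i$): (1) there is a unit vector $h\in\mathbb{R}^d$ such that $X_0h^T\ge\mathbf{0}_{n,1}$ entrywise and $X_0h^T\neq\mathbf{0}_{n,1}$; (2) the rank of $X_0$ is $n$ (and, if $d\ge n$, this is the case for all $X_0\in\mathbb{S}(n,d,\bar\gamma)$ except a set of measure zero); (3) there is a nonzero column $c$ of $X_0$ such that $c^T\notin\mathcal{C}^\perp(A)$,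 where $$\mathcal{C}^\perp(A)=\{x\in\mathbb{R}^n:\exists y\in\mathcal{C}(A)\text{ such that } y\ne\mathbf{0}_{1,n},\ yx^T=0\}.$$
   Context: Vectors are row vectors; $[X]_i$ is the $i$-th row of a matrix $X$; $\mathbf{0}_{n,m}$ is the $n\times m$ zero matrix. $\mathbb{S}^{d-1}=\{x\in\mathbb{R}^d:\|x\|_2=1\}$. Nonnegative weight matrix: $A=[a_{ij}]\in\mathbb{R}^{n\times n}$ is a nonnegative weight matrix for a directed graph with nodes $\{1,\dots,n\}$ and edge set $\mathcal{E}$ if $a_{ij}>0$ for $(i,j)\in\mathcal{E}$ and $a_{ij}=0$ for $(i,j)\notin\mathcal{E}$ (self-loops are allowed). Minimum cone of a nonnegative matrix $B\in\mathbb{R}^{n\times n}$: $\mathcal{C}(B)=\{\sum_{i=1}^n\lambda_i[B]_i:\lambda_i\ge0\ \forall i\}$. A directional function on $\mathbb{S}^{d-1}$ is a continuous function $\gamma:\mathbb{S}^{d-1}\to\mathbb{R}^+$ bounded above and below by positive constants. Its star boundary is $\mathbb{S}^{d-1}_\gamma=\{\gamma(x)x:x\in\mathbb{S}^{d-1}\}$. For $\bar\gamma=(\gamma_1,\dots,\gamma_n)$, $\mathbb{S}(n,d,\bar\gamma)=\{X\in\mathbb{R}^{n\times d}:[X]_i\in\mathbb{S}^{d-1}_{\gamma_i}\ \forall i\}$. Measure zero in $\mathbb{S}(n,d,\bar\gamma)$ is understood with respect to the product of the surface measures on $(\mathbb{S}^{d-1})^n$, transported by the homeomorphism $(u_1,\dots,u_n)\mapsto$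 the matrix with rows $\gamma_i(u_i)u_i$. Row-wise radial projection: for $X\in\mathbb{R}^{n\times d}$ with no zero rows, $P_{\mathbb{S}(n,d,\bar\gamma)}(X)$ is the $n\times d$ matrix whose $i$-th row is $\gamma_i\!\left(\frac{[X]_i}{\|[X]_i\|_2}\right)\frac{[X]_i}{\|[X]_i\|_2}$. (Under the stated inequality on $A$ and $\bar\gamma$, $AX$ has no zero rows for any $X\in\mathbb{S}(n,d,\bar\gamma)$, so the iteration is well defined.) For a matrix $B\in\mathbb{R}^{n\times d}$ with nonzero rows, let $D_{\bar\gamma}(B)=\mathrm{diag}\left(\frac{\gamma_1([B]_1/\|[B]_1\|_2)}{\|[B]_1\|_2},\dots,\frac{\gamma_n([B]_n/\|[B]_n\|_2)}{\|[B]_n\|_2}\right)$. For $k\ge1$ let $$\tilde A(k,t_0,X_0)=D_{\bar\gamma}(AX(t_0+k-1))A\,D_{\bar\gamma}(AX(t_0+k-2))A\cdots D_{\bar\gamma}(AX(t_0))A,$$ so that $X(t_0+k)=\tilde A(k,t_0,X_0)X_0$. Under the stated assumptions, for every $i$ the normalized rows $\frac{[\tilde A(k,t_0,X_0)]_i}{\|[\tilde A(k,t_0,X_0)]_i\|_2}$ converge as $k\to\infty$ to a common limit in $\mathbb{S}^{n-1}$ with strictly positive entries, independent of $i$ and $t_0$; $v(X_0)\in\mathbb{S}^{n-1}$ denotes this limit. *)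

(* Defs.v *)
(* MathComp-Analysis; the reals are an arbitrary R : realType. *)
From HB Require Import structures.
From mathcomp Require Export all_boot all_order all_algebra.
From mathcomp Require Export all_classical all_reals all_analysis.

Set Implicit Arguments.
Unset Strict Implicit.
Unset Printing Implicit Defensive.

Export Order.TTheory GRing.Theory Num.Theory.
Export numFieldNormedType.Exports.

Local Open Scope classical_set_scope.
Local Open Scope ring_scope.

Section sphere.
Context {R : realType}.

(* The library's norm `|x| on 'rV[R]_d is the sup norm. *)
Definition norm2 d (x : 'rV[R]_d) : R := Num.sqrt (\sum_j x 0 j ^+ 2).

Definition unit_sphere d : set 'rV[R]_d := [set x | norm2 x = 1].

Definition normalize d (x : 'rV[R]_d) : 'rV[R]_d := (norm2 x)^-1 *: x.

(* Only the values on the sphere matter. *)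
Definition directional d (g : 'rV[R]_d -> R) : Prop :=
  {within @unit_sphere d, continuous g} /\
  exists m M : R, 0 < m /\ forall x, unit_sphere x -> m <= g x <= M.

(* For a directional function the infimum and the supremum are attained, the
   sphere being compact, and nonempty when d >= 1. *)
Definition sphere_min d (g : 'rV[R]_d -> R) : R := inf (g @` @unit_sphere d).
Definition sphere_max d (g : 'rV[R]_d -> R) : R := sup (g @` @unit_sphere d).

Definition star_boundary d (g : 'rV[R]_d -> R) : set 'rV[R]_d :=
  [set g x *: x | x in @unit_sphere d].

Definition star_product n d (gam : 'I_n -> 'rV[R]_d -> R) : set 'M[R]_(n, d) :=
  [set X | forall i, star_boundary (gam i) (row i X)].

End sphere.

Section graph.
Context {R : realType}.

Definition strongly_connected n (e : rel 'I_n) : Prop :=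
  forall i j, connect e i j.

Definition nonneg_weight_matrix n (e : rel 'I_n) (A : 'M[R]_n) : Prop :=
  forall i j, (e i j -> 0 < A i j) /\ (~~ e i j -> A i j = 0).

Definition min_cone n (B : 'M[R]_n) : set 'rV[R]_n :=
  [set y | exists l : 'I_n -> R,
     (forall i, 0 <= l i) /\ y = \sum_i l i *: row i B].

Definition min_cone_perp n (B : 'M[R]_n) : set 'rV[R]_n :=
  [set x | exists y, [/\ min_cone B y, y <> 0 & y *m x^T = 0]].

End graph.

Section dynamics.
Context {R : realType} {n d : nat}.
Variables (gam : 'I_n -> 'rV[R]_d -> R) (A : 'M[R]_n).

Definition radial_proj (X : 'M[R]_(n, d)) : 'M[R]_(n, d) :=
  \matrix_(i < n) (gam i (normalize (row i X)) *: normalize (row i X)).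

Definition trajectory (t0 : nat) (X0 : 'M[R]_(n, d))
    (X : nat -> 'M[R]_(n, d)) : Prop :=
  X t0 = X0 /\ forall t, (t0 <= t)%N -> X t.+1 = radial_proj (A *m X t).

Definition scaling_mx (B : 'M[R]_(n, d)) : 'M[R]_n :=
  diag_mx (\row_i (gam i (normalize (row i B)) / norm2 (row i B))).

Fixpoint transition_mx (t0 : nat) (X : nat -> 'M[R]_(n, d)) (k : nat) :
    'M[R]_n :=
  if k is k'.+1
  then scaling_mx (A *m X (t0 + k')%N) *m A *m transition_mx t0 X k'
  else 1%:M.

Definition is_limit_direction (X0 : 'M[R]_(n, d)) (v : 'rV[R]_n) : Prop :=
  forall (t0 : nat) (X : nat -> 'M[R]_(n, d)), trajectory t0 X0 X ->
  forall i, normalize (row i (transition_mx t0 X k)) @[k --> \oo] --> v.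

(* Would be 0 if there were no common limit; for n >= 1 there is at most one. *)
Definition limit_direction (X0 : 'M[R]_(n, d)) : 'rV[R]_n :=
  xget 0 [set v | is_limit_direction X0 v].

Definition direction_consensus (X : nat -> 'M[R]_(n, d)) : Prop :=
  exists u, unit_sphere u /\
  forall i, normalize (row i (X t)) @[t --> \oo] --> u.

End dynamics.

Section tuple_measure.
Context {R : realType} {dsp : measure_display} {T : measurableType dsp}.
Variable mu : set T -> \bar R.
Local Open Scope ereal_scope.

(* The n-fold product mu \x (mu \x ...), transported to n.-tuple T. *)
Fixpoint tuple_measure (n : nat) : set (n.-tuple T) -> \bar R :=
  match n return set (n.-tuple T) -> \bar R with
  | 0 => \d_ ([tuple] : 0.-tuple T)
  | m.+1 => pushforward (mu \x @tuple_measure m)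
              (fun p : T * m.-tuple T => [tuple of p.1 :: p.2])
  end.

End tuple_measure.
Arguments tuple_measure {R dsp T} mu n _.

Section measures.
Context {R : realType}.
Local Open Scope ereal_scope.

(* R^d as a measurable space: d.-tuple R with its product (Borel)
   sigma-algebra. *)
Definition row_of d (t : d.-tuple R) : 'rV[R]_d := \row_j tnth t j.

Definition lebesgue_measure_d (d : nat) : set (d.-tuple R) -> \bar R :=
  tuple_measure (T := R) (@lebesgue_measure R) d.

(* sigma(E) = d * lambda_d {r u | u \in E, |u| = 1, 0 < r <= 1}, seen as a
   measure on R^d carried by the sphere; this is the (d-1)-dimensional area
   (counting measure on {-1, 1} if d = 1), by integration in polar
   coordinates. *)
Definition surface_measure (d : nat) (E : set (d.-tuple R)) : \bar R :=
  d%:R%:E * lebesgue_measure_d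
    [set t | exists u (r : R), [/\ E u, unit_sphere (row_of u),
       (0 < r <= 1)%R & row_of t = (r *: row_of u)%R]].

Definition star_point n d (gam : 'I_n -> 'rV[R]_d -> R)
    (U : n.-tuple (d.-tuple R)) : 'M[R]_(n, d) :=
  (\matrix_(i < n) (gam i (row_of (tnth U i)) *: row_of (tnth U i)))%R.

Definition star_null n d (gam : 'I_n -> 'rV[R]_d -> R)
    (E : set 'M[R]_(n, d)) : Prop :=
  (tuple_measure (@surface_measure d) n).-negligible
    [set U | (forall i, unit_sphere (row_of (tnth U i))) /\
             E (star_point gam U)].

End measures.

(* Main.v *)
(* Write T_k = D(A X(t0 + k)) A.  The dominance assumption bounds the norms of
   the rows of A X away from 0 and infinity on the star product, so the T_k have
   entries at most C, and at least c > 0 on the edges and on the diagonal; every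
   product of n consecutive T_k then has all entries in some [a, b] with a > 0.
   If m y <= x <= M y for two vectors with y > 0, applying such a product
   shrinks M - m by the factor 1 - a / b.  With x a column of the transition
   matrix and y the vector of its row sums, all rows become proportional to one
   positive vector.

   X(t0 + k) is the transition matrix times X0, so consensus follows as soon as
   v X0 <> 0.  Conditions (1) and (2) give this from v > 0, and (3) because v lies
   in the cone of A.

   For the null set, the cone over a subset of a proper subspace lies in a
   hyperplane, hence a proper subspace is null for the surface measure; almost
   every choice of n <= d directions is then linearly independent, one vector at
   a time. *)
Require Import Defs.
From mathcomp Require Import perm measurable_realfun ring lra.

Set Implicit Arguments.
Unset Strict Implicit.
Unset Printing Implicit Defensive.

Local Open Scope classical_set_scope.
Local Open Scope ring_scope.

(** * Products of nonnegative matrices *)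

Section positive_products.
Context {R : realType} {n : nat}.
Implicit Type T : nat -> 'M[R]_n.

Fixpoint mxprod T (s k : nat) : 'M[R]_n :=
  if k is k'.+1 then T (s + k')%N *m mxprod T s k' else 1%:M.

Lemma mxprodD T s k l : mxprod T s (k + l) = mxprod T (s + k) l *m mxprod T s k.
Proof.
elim: l => [|l IH]; first by rewrite addn0 mul1mx.
by rewrite addnS /= IH mulmxA addnA.
Qed.

Lemma mxprod_ge0 T s k i j :
  (forall k i j, 0 <= T k i j) -> 0 <= mxprod T s k i j.
Proof.
move=> T0; elim: k i j => [|k IH] i j /=; rewrite !mxE ?ler0n//.
by apply: sumr_ge0 => l _; apply: mulr_ge0.
Qed.

(** The leftmost factor takes the first step of the path; once the path is used up, each remaining
    factor contributes a diagonal entry. All other terms are nonnegative. *)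
Lemma mxprod_path T (e : rel 'I_n) c s k i p :
  0 <= c -> (forall k i j, 0 <= T k i j) ->
  (forall k i j, (i == j) || e i j -> c <= T k i j) ->
  path e i p -> (size p <= k)%N -> c ^+ k <= mxprod T s k i (last i p).
Proof.
move=> c0 T0 Tc; elim: k i p => [|k IH] i [|l p]//=.
- by move=> _ _; rewrite mxE eqxx expr0.
- move=> _ _; rewrite exprS mxE (bigD1 i)//=; apply: ler_wpDr.
    by apply: sumr_ge0 => l _; apply: mulr_ge0 => //; exact: mxprod_ge0.
  apply: ler_pM; rewrite ?exprn_ge0 ?Tc ?eqxx//.
  exact: (IH i [::]).
- move=> /andP[eil pth] sz; rewrite exprS mxE (bigD1 l)//=; apply: ler_wpDr.
    by apply: sumr_ge0 => l' _; apply: mulr_ge0 => //; exact: mxprod_ge0.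
  by apply: ler_pM; rewrite ?exprn_ge0 ?Tc ?eil ?orbT// IH.
Qed.

(** A simple path has fewer than [n] edges, so [n] factors suffice for any connected pair. *)
Lemma mxprod_lower_bound T (e : rel 'I_n) c s i j :
  0 <= c -> (forall k i j, 0 <= T k i j) ->
  (forall k i j, (i == j) || e i j -> c <= T k i j) ->
  connect e i j -> c ^+ n <= mxprod T s n i j.
Proof.
move=> c0 T0 Tc /connectP[p pth ->].
case: (shortenP pth) => p' pth' up' _.
apply: (@mxprod_path _ e) => //.
by have := max_card (mem (i :: p')); rewrite card_ord (card_uniqP up'); apply: ltnW.
Qed.

(** The bound may grow with [k] but not with [s], so it serves all blocks of length [k]. *)
Lemma mxprod_upper_bound T C k :
  (forall k i j, 0 <= T k i j <= C) ->
  exists b, forall s i j, mxprod T s k i j <= b.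
Proof.
move=> TC; elim: k => [|k [b IH]].
  by exists 1 => s i j; rewrite mxE lern1 leq_b1.
exists (\sum_(l < n) C * b) => s i j; rewrite mxE; apply: ler_sum => l _.
have /andP[Tsk0 TskC] := TC (s + k)%N i l.
by apply: ler_pM => //; apply: mxprod_ge0 => k' i' j'; have /andP[] := TC k' i' j'.
Qed.

(** * Contraction of the ratios between columns and row sums *)

Variables (T : nat -> 'M[R]_n) (e : rel 'I_n) (c C : R).
Hypotheses (c_gt0 : 0 < c) (Tc : forall k i j, (i == j) || e i j -> c <= T k i j)
  (TC : forall k i j, 0 <= T k i j <= C) (e_conn : forall i j, connect e i j).

Let P := mxprod T 0.
Let y k i := \sum_j P k i j.

Let T_ge0 k i j : 0 <= T k i j. Proof. by case/andP: (TC k i j). Qed.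
Let P_ge0 s k i j : 0 <= mxprod T s k i j. Proof. exact: mxprod_ge0. Qed.

Lemma row_sum_mxprod_gt0 k i : 0 < y k i.
Proof.
rewrite /y (bigD1 i)//=; apply: ltr_wpDr; first by apply: sumr_ge0 => j _; exact: P_ge0.
apply: lt_le_trans (exprn_gt0 k c_gt0) _.
by apply: (@mxprod_path T e c 0 k i [::]) => //; exact: ltW.
Qed.

(** Column [j] and the row sums [y] are propagated by the same products, so bounds on their ratio
    persist in time; [bracket_contract] tightens them. *)
Let bracket j k m M := forall i, m * y k i <= P k i j <= M * y k i.

Let yD s k i : y (s + k) i = \sum_l mxprod T s k i l * y s l.
Proof.
rewrite /y /P; under eq_bigr => j _ do rewrite mxprodD add0n mxE.
by rewrite exchange_big; apply: eq_bigr => l _; rewrite mulr_sumr.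
Qed.

Let PD s k i j : P (s + k) i j = \sum_l mxprod T s k i l * P s l j.
Proof. by rewrite /P mxprodD add0n mxE. Qed.

Let lowD j s k i m : P (s + k) i j - m * y (s + k) i =
  \sum_l mxprod T s k i l * (P s l j - m * y s l).
Proof.
rewrite PD yD mulr_sumr -sumrB; apply: eq_bigr => l _; ring.
Qed.

Let bracket_later j s k m M : bracket j s m M -> bracket j (s + k) m M.
Proof.
move=> B i; apply/andP; split.
  rewrite -subr_ge0 lowD; apply: sumr_ge0 => l _; apply: mulr_ge0 => //.
  by rewrite subr_ge0; case/andP: (B l).
rewrite -subr_le0 lowD -oppr_ge0 -sumrN; apply: sumr_ge0 => l _.
by rewrite -mulrN mulr_ge0// opprB subr_ge0; case/andP: (B l).
Qed.

(* With S = sum (x - m y) and S' = sum (M y - x) at time s, the block product,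
   whose entries lie in [a, b], gives x - m y >= a S, M y - x >= a S' and
   y <= b Y at time s + n, while S + S' = (M - m) Y. *)
Let bracket_contract a b j s m M : 'I_n -> 0 < a ->
  (forall s i j, a <= mxprod T s n i j <= b) -> bracket j s m M ->
  exists m' M', bracket j (s + n) m' M' /\ M' - m' = (1 - a / b) * (M - m).
Proof.
move=> i0 a0 ab B.
have b0 : 0 < b by case/andP: (ab 0%N i0 i0) => /(lt_le_trans a0) /lt_le_trans; apply.
pose Y := \sum_l y s l.
have Y0 : 0 < Y.
  rewrite /Y (bigD1 i0)//=; apply: ltr_wpDr; last exact: row_sum_mxprod_gt0.
  by apply: sumr_ge0 => l _; exact/ltW/row_sum_mxprod_gt0.
pose S := \sum_l (P s l j - m * y s l).
pose S' := \sum_l (M * y s l - P s l j).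
have S0 : 0 <= S.
  by apply: sumr_ge0 => l _; rewrite subr_ge0; case/andP: (B l).
have S'0 : 0 <= S'.
  by apply: sumr_ge0 => l _; rewrite subr_ge0; case/andP: (B l).
have SS' : S + S' = (M - m) * Y.
  rewrite /S /S' /Y mulr_sumr -big_split; apply: eq_bigr => l _ /=; ring.
have yb i : y (s + n) i <= b * Y.
  rewrite yD /Y mulr_sumr; apply: ler_sum => l _.
  by apply: ler_wpM2r; [exact/ltW/row_sum_mxprod_gt0|case/andP: (ab s i l)].
(* Since [y (s + n) i <= b * Y], a gain of [a * U] is at least a fixed multiple of [y (s + n) i], as
   a bracket requires. *)
have aux i U : 0 <= U -> a / b * (U / Y) * y (s + n) i <= a * U.
  move=> U0; apply: le_trans (_ : a / b * (U / Y) * (b * Y) <= _).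
    apply: ler_wpM2l (yb i).
    by rewrite !mulr_ge0// ?invr_ge0 ltW.
  suff -> : a / b * (U / Y) * (b * Y) = a * U by [].
  by field; rewrite !gt_eqF.
exists (m + a / b * (S / Y)), (M - a / b * (S' / Y)); split; last first.
  have -> : M - a / b * (S' / Y) - (m + a / b * (S / Y)) =
    M - m - a / b * ((S + S') / Y) by ring.
  by rewrite SS' mulfK ?gt_eqF//; ring.
move=> i; apply/andP; split.
  rewrite mulrDl -lerBrDl; apply: le_trans (aux i _ S0) _.
  rewrite lowD mulr_sumr; apply: ler_sum => l _.
  by apply: ler_wpM2r; [rewrite subr_ge0; case/andP: (B l)|case/andP: (ab s i l)].
rewrite mulrBl lerBrDr -lerBrDl; apply: le_trans (aux i _ S'0) _.
rewrite -opprB lowD -sumrN mulr_sumr; apply: ler_sum => l _.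
rewrite -mulrN opprB.
by apply: ler_wpM2r; [rewrite subr_ge0; case/andP: (B l)|case/andP: (ab s i l)].
Qed.

(** Brackets of length [q ^+ p] at time [p * n] close on a single number, the supremum of all lower
    bounds at all times, which lies in every bracket. *)
Lemma row_ratio_cvg (i0 : 'I_n) : exists L : 'rV[R]_n, (forall j, 0 < L 0 j) /\
  forall i j, (P k i j / y k i) @[k --> \oo] --> L 0 j.
Proof.
have [b Pb] := mxprod_upper_bound n TC.
pose a := c ^+ n.
have a0 : 0 < a by exact: exprn_gt0.
have ab s i j : a <= mxprod T s n i j <= b.
  by rewrite Pb andbT; apply: (mxprod_lower_bound _ (ltW c_gt0) T_ge0 Tc).
have b0 : 0 < b.
  by case/andP: (ab 0%N i0 i0) => /(lt_le_trans a0) /lt_le_trans; apply.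
pose q := 1 - a / b.
have q1 : `|q| < 1.
  have a_b : a <= b by case/andP: (ab 0%N i0 i0) => /le_trans; apply.
  rewrite ger0_norm ?subr_ge0 ?ler_pdivrMr ?mul1r//.
  by rewrite ltrBlDr ltrDl divr_gt0.
have shrink j p : exists m M, bracket j (p * n) m M /\ M - m = q ^+ p.
  elim: p => [|p [m [M [B Mm]]]].
    (* The starting bracket is [[0, 1]]: an entry is one nonnegative term of its row sum. *)
    exists 0, 1; split; last by rewrite subr0 expr0.
    move=> i; rewrite mul0r mul1r P_ge0 /y (bigD1 j)//= lerDl.
    by apply: sumr_ge0 => l _; exact: P_ge0.
  have [m' [M' [B' Mm']]] := bracket_contract i0 a0 ab B.
  by exists m', M'; rewrite mulSn addnC Mm' Mm exprS.
pose lows j := [set m : R | exists k, forall i, m * y k i <= P k i j].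
pose L := \row_j sup (lows j).
have LP j k m M : bracket j k m M -> m <= L 0 j <= M.
  move=> B; have ub : ubound (lows j) M.
    move=> m' [k' B'].
    (* The upper bound 1 always holds; carrying both brackets to time [k + k'] compares [m'] with
       [M]. *)
    have {}B' : bracket j k' m' 1.
      move=> i; rewrite B' mul1r /y (bigD1 j)//= lerDl.
      by apply: sumr_ge0 => l _; exact: P_ge0.
    have := bracket_later k' B; have := bracket_later k B'.
    rewrite addnC => /(_ i0)/andP[le1 _] /(_ i0)/andP[_ le2].
    by have := le_trans le1 le2; rewrite ler_pM2r// row_sum_mxprod_gt0.
  have lm : lows j m by exists k => i; case/andP: (B i).
  rewrite mxE; apply/andP; split.
    by apply: ub_le_sup => //; exists M.
  by apply: ge_sup => //; exists m.
exists L; split=> [j|i j].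
  (* [Y] is [n] times [b] and bounds the row sums at time [n], when every entry is at least [a]; so
     [a / Y] is a positive lower bound of the ratio. *)
  pose Y := \sum_(l < n) b.
  have Y0 : 0 < Y.
    rewrite /Y (bigD1 i0)//=; apply: ltr_wpDr => //.
    by apply: sumr_ge0 => l _; exact: ltW.
  suff B : bracket j n (a / Y) 1.
    by case/andP: (LP _ _ _ _ B) => + _; apply: lt_le_trans; exact: divr_gt0.
  move=> i; rewrite mul1r; apply/andP; split; last first.
    by rewrite /y (bigD1 j)//= lerDl; apply: sumr_ge0 => l _; exact: P_ge0.
  apply: le_trans (_ : a <= _); last by case/andP: (ab 0%N i j).
  rewrite mulrAC ler_pdivrMr// ler_wpM2l ?(ltW a0)//.
  by apply: ler_sum => l _; case/andP: (ab 0%N i l).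
apply/cvgrPdist_le => eps eps0.
have [p qp] : exists p, q ^+ p <= eps.
  have /cvgrPdist_le /(_ eps eps0) [p _ Hp] := cvg_expr q1.
  exists p; have := Hp p (leqnn _); rewrite sub0r normrN.
  exact/le_trans/ler_norm.
have [m [M [B Mm]]] := shrink j p.
near=> k.
have pk : (p * n <= k)%N by near: k; exact: nbhs_infty_ge.
have {}B : bracket j k m M by rewrite -(subnKC pk); exact: bracket_later.
have /andP[mL LM] := LP _ _ _ _ B.
have /andP[mr rM] := B i.
have yk := row_sum_mxprod_gt0 k i.
have {}mr : m <= P k i j / y k i by rewrite ler_pdivlMr.
have {}rM : P k i j / y k i <= M by rewrite ler_pdivrMr.
rewrite ler_norml; apply/andP; split; lra.
Unshelve. all: by end_near.
Qed.

End positive_products.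

(** * Euclidean norm and normalization *)

Section euclidean_norm.
Context {R : realType}.

Lemma norm2_ge0 d (x : 'rV[R]_d) : 0 <= norm2 x.
Proof. exact: sqrtr_ge0. Qed.

Lemma norm2_eq0 d (x : 'rV[R]_d) : (norm2 x == 0) = (x == 0).
Proof.
rewrite /norm2 sqrtr_eq0; apply/idP/eqP => [x0|->]; last first.
  by rewrite big1// => j _; rewrite mxE expr0n.
apply/rowP => j; rewrite mxE; apply/eqP; rewrite -sqrf_eq0 eq_le sqr_ge0 andbT.
apply: le_trans x0; rewrite (bigD1 j)//= lerDl.
by apply: sumr_ge0 => k _; exact: sqr_ge0.
Qed.

Lemma norm2_gt0 d (x : 'rV[R]_d) : (0 < norm2 x) = (x != 0).
Proof. by rewrite lt0r norm2_eq0 norm2_ge0 andbT. Qed.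

Lemma norm2Z d c (x : 'rV[R]_d) : norm2 (c *: x) = `|c| * norm2 x.
Proof.
rewrite /norm2 -sqrtr_sqr -sqrtrM ?sqr_ge0// mulr_sumr; congr Num.sqrt.
by apply: eq_bigr => j _; rewrite mxE exprMn.
Qed.

Lemma unit_sphere_neq0 d (x : 'rV[R]_d) : unit_sphere x -> x != 0.
Proof. by rewrite /unit_sphere /= => x1; rewrite -norm2_gt0 x1. Qed.

Lemma unit_sphere_normalize d (x : 'rV[R]_d) :
  x != 0 -> unit_sphere (normalize x).
Proof.
rewrite -norm2_gt0 /unit_sphere /= /normalize norm2Z => x0.
by rewrite ger0_norm ?invr_ge0 ?ltW// mulVf// gt_eqF.
Qed.

Lemma normalizeZ d c (x : 'rV[R]_d) : 0 < c -> normalize (c *: x) = normalize x.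
Proof.
move=> c0; rewrite /normalize norm2Z gtr0_norm// scalerA invfM.
by rewrite mulrAC mulVf ?mul1r// gt_eqF.
Qed.

Lemma unit_sphere_nonempty d : (1 <= d)%N -> exists u : 'rV[R]_d, unit_sphere u.
Proof.
case: d => // d _; exists (normalize (const_mx 1)); apply: unit_sphere_normalize.
by apply/rV0Pn; exists 0; rewrite mxE oner_eq0.
Qed.

Lemma norm2_sqr d (x : 'rV[R]_d) : norm2 x ^+ 2 = \sum_j x 0 j ^+ 2.
Proof. by rewrite sqr_sqrtr//; apply: sumr_ge0 => j _; exact: sqr_ge0. Qed.

(** * Inner products with unit vectors *)

Definition dotr d (x y : 'rV[R]_d) : R := \sum_j x 0 j * y 0 j.

Lemma dotrZl d c (x y : 'rV[R]_d) : dotr (c *: x) y = c * dotr x y.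
Proof. by rewrite mulr_sumr; apply: eq_bigr => j _; rewrite mxE mulrA. Qed.

Lemma dotr_suml (I : finType) (P : pred I) d (F : I -> 'rV[R]_d) (y : 'rV[R]_d) :
  dotr (\sum_(i | P i) F i) y = \sum_(i | P i) dotr (F i) y.
Proof.
rewrite exchange_big; apply: eq_bigr => j _.
by rewrite summxE mulr_suml.
Qed.

(** Expanding the nonnegative squared norms of [x + y] and [x - y] gives the two bounds. *)
Lemma dotr_unit_bound d (x y : 'rV[R]_d) :
  unit_sphere x -> unit_sphere y -> -1 <= dotr x y <= 1.
Proof.
rewrite /unit_sphere /= => x1 y1.
have Hp : \sum_j (x 0 j + y 0 j) ^+ 2 = 2 + 2 * dotr x y.
  transitivity (norm2 x ^+ 2 + norm2 y ^+ 2 + 2 * dotr x y).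
    rewrite !norm2_sqr mulr_sumr -!big_split; apply: eq_bigr => j _ /=; ring.
  by rewrite x1 y1; ring.
have Hm : \sum_j (x 0 j - y 0 j) ^+ 2 = 2 - 2 * dotr x y.
  transitivity (norm2 x ^+ 2 + norm2 y ^+ 2 - 2 * dotr x y).
    rewrite !norm2_sqr mulr_sumr -sumrN -!big_split; apply: eq_bigr => j _ /=; ring.
  by rewrite x1 y1; ring.
have : 0 <= \sum_j (x 0 j + y 0 j) ^+ 2 by apply: sumr_ge0 => j _; exact: sqr_ge0.
have : 0 <= \sum_j (x 0 j - y 0 j) ^+ 2 by apply: sumr_ge0 => j _; exact: sqr_ge0.
rewrite Hp Hm => h1 h2; apply/andP; split; lra.
Qed.

Lemma scale_normalize d (x : 'rV[R]_d) : x = norm2 x *: normalize x.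
Proof.
have [->|x0] := eqVneq x 0; first by rewrite /normalize !scaler0.
by rewrite scalerA divff ?scale1r// norm2_eq0.
Qed.

(** Together with [dotr_normalize], it turns norm estimates into estimates of linear functionals. *)
Lemma dotr_le_norm2 d (x u : 'rV[R]_d) : unit_sphere u -> dotr x u <= norm2 x.
Proof.
move=> u1; have [->|x0] := eqVneq x 0.
  by rewrite /dotr big1 ?norm2_ge0// => j _; rewrite mxE mul0r.
rewrite [in leLHS](scale_normalize x) dotrZl -[leRHS]mulr1 ler_wpM2l ?norm2_ge0//.
by case/andP: (dotr_unit_bound (unit_sphere_normalize x0) u1).
Qed.

Lemma dotr_normalize d (x : 'rV[R]_d) : dotr x (normalize x) = norm2 x.
Proof.
have [->|x0] := eqVneq x 0.
  rewrite /dotr big1; first by apply/esym/eqP; rewrite norm2_eq0.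
  by move=> j _; rewrite mxE mul0r.
transitivity ((norm2 x)^-1 * norm2 x ^+ 2).
  by rewrite norm2_sqr mulr_sumr; apply: eq_bigr => j _; rewrite mxE; ring.
by rewrite expr2 mulKf ?norm2_eq0.
Qed.

(** * Limits of vectors and matrices *)

Lemma cvg_sum (I : Type) (r : seq I) (F : set_system nat) (FF : Filter F)
    (f : I -> nat -> R) (a : I -> R) :
  (forall i, f i k @[k --> F] --> a i) ->
  (\sum_(i <- r) f i k) @[k --> F] --> \sum_(i <- r) a i.
Proof.
by move=> fa; apply: cvg_big => //; exact: add_continuous.
Qed.

Lemma cvg_mxP m p (F : set_system nat) (FF : Filter F)
    (f : nat -> 'M[R]_(m, p)) (M : 'M[R]_(m, p)) :
  (forall i j, (f k i j) @[k --> F] --> M i j) -> (f k) @[k --> F] --> M.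
Proof.
move=> fM; apply/cvg_ballP => eps eps0.
have : \forall k \near F, forall i j, ball (M i j) eps (f k i j).
  apply: filter_forall => i; apply: filter_forall => j.
  by have /cvg_ballP := fM i j; apply.
by apply: filterS.
Qed.

Lemma cvg_coord m p (F : set_system nat) (FF : Filter F)
    (f : nat -> 'M[R]_(m, p)) (M : 'M[R]_(m, p)) i j :
  (f k) @[k --> F] --> M -> (f k i j) @[k --> F] --> M i j.
Proof. by move=> fM; exact: (cvg_comp _ _ fM (@coord_continuous R _ _ i j M)). Qed.

Lemma cvg_mulmxr m p q (F : set_system nat) (FF : Filter F)
    (f : nat -> 'M[R]_(m, p)) (M : 'M[R]_(m, p)) (B : 'M[R]_(p, q)) :
  (f k) @[k --> F] --> M -> (f k *m B) @[k --> F] --> M *m B.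
Proof.
move=> fM; apply: cvg_mxP => i j; rewrite mxE.
under eq_fun do rewrite mxE.
apply: cvg_sum => l; apply: cvgM; last exact: cvg_cst.
exact: cvg_coord.
Qed.

Lemma cvg_normalize d (F : set_system nat) (FF : Filter F)
    (f : nat -> 'rV[R]_d) (x : 'rV[R]_d) :
  x != 0 -> (f k) @[k --> F] --> x -> (normalize (f k)) @[k --> F] --> normalize x.
Proof.
move=> x0 fx.
have fxj j : (f k 0 j) @[k --> F] --> x 0 j.
  exact: cvg_coord.
have nf : (norm2 (f k)) @[k --> F] --> norm2 x.
  suff : (\sum_j f k 0 j ^+ 2) @[k --> F] --> \sum_j x 0 j ^+ 2.
    by move=> h; exact: (cvg_comp _ _ h (@sqrt_continuous R _)).
  apply: cvg_sum => j; rewrite expr2; under eq_fun do rewrite expr2.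
  exact: cvgM.
apply: cvg_mxP => i j; rewrite mxE (ord1 i); under eq_fun do rewrite mxE.
apply: cvgM => //; apply: cvgV => //.
by rewrite norm2_eq0.
Qed.

End euclidean_norm.

(** * The radial dynamics *)

Lemma fin_pos_lower_bound (R : realType) (I : finType) (f : I -> R) :
  (forall i, 0 < f i) -> exists2 c, 0 < c & forall i, c <= f i.
Proof.
(* The sum dominates each reciprocal; the extra 1 keeps the witness positive when [I] is empty. *)
move=> f0; exists (1 + \sum_i (f i)^-1)^-1.
  rewrite invr_gt0; apply: ltr_pwDl => //.
  by apply: sumr_ge0 => i _; rewrite invr_ge0 ltW.
move=> i; rewrite -[leRHS]invrK lef_pV2 ?posrE ?invr_gt0//.
  rewrite (bigD1 i)//= addrCA lerDl addr_ge0//.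
  by apply: sumr_ge0 => j _; rewrite invr_ge0 ltW.
apply: ltr_pwDl => //.
by apply: sumr_ge0 => j _; rewrite invr_ge0 ltW.
Qed.

Section radial_dynamics.
Context {R : realType} {n d : nat}.
Variables (gam : 'I_n -> 'rV[R]_d -> R) (A : 'M[R]_n) (e : rel 'I_n).
Variables lo hi : 'I_n -> R.
Hypotheses (d_gt0 : (1 <= d)%N) (lo_gt0 : forall i, 0 < lo i)
  (gam_bd : forall i u, unit_sphere u -> lo i <= gam i u <= hi i)
  (wA : nonneg_weight_matrix e A)
  (domA : forall i, \sum_(j | j != i) A i j * hi j < A i i * lo i)
  (e_conn : strongly_connected e).

Implicit Type X : 'M[R]_(n, d).

Let delta i := A i i * lo i - \sum_(j | j != i) A i j * hi j.
Let K i := \sum_j A i j * hi j.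

Let lohi i : lo i <= hi i.
Proof.
have [u /(gam_bd i) /andP[lou uhi]] := unit_sphere_nonempty (R := R) d_gt0.
exact: le_trans lou uhi.
Qed.

Let hi_gt0 i : 0 < hi i. Proof. exact: lt_le_trans (lohi i). Qed.

Let gam_gt0 i u : unit_sphere u -> 0 < gam i u.
Proof. by move=> /(gam_bd i) /andP[+ _]; exact: lt_le_trans. Qed.

Let A_ge0 i j : 0 <= A i j.
Proof.
have [Ae AN] := wA i j.
by have [/Ae/ltW|/AN->] := boolP (e i j).
Qed.

Let A_diag_gt0 i : 0 < A i i.
Proof.
rewrite -(pmulr_lgt0 _ (lo_gt0 i)); apply: le_lt_trans (domA i).
by apply: sumr_ge0 => j _; rewrite mulr_ge0// ltW.
Qed.

Let delta_gt0 i : 0 < delta i. Proof. by rewrite subr_gt0. Qed.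

Lemma star_product_row X i : star_product gam X ->
  exists2 u, unit_sphere u & row i X = gam i u *: u.
Proof. by move=> /(_ i) [u u1 <-]; exists u. Qed.

Let row_mulmx X i : row i (A *m X) = \sum_j A i j *: row j X.
Proof.
by rewrite row_mul mulmx_sum_row; apply: eq_bigr => j _; rewrite mxE.
Qed.

Let dotr_row_bound X j u : star_product gam X -> unit_sphere u ->
  - hi j <= dotr (row j X) u <= hi j.
Proof.
move=> SX u1; have [w w1 ->] := star_product_row j SX.
have /andP[? h1] := gam_bd j w1; have g0 := gam_gt0 j w1.
have /andP[h2 h3] := dotr_unit_bound w1 u1.
rewrite dotrZl; apply/andP; split; nra.
Qed.

(** For the lower bound, row [i] of [A X] is tested against the direction of row [i] of [X]: the
    diagonal term gives at least [A i i * lo i], and each other term loses at most [A i j * hi j].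
    For the upper bound it is tested against its own direction. *)
Lemma norm2_row_bounds X : star_product gam X -> forall i,
  delta i <= norm2 (row i (A *m X)) <= K i.
Proof.
move=> SX i; apply/andP; split.
  have [u u1 uX] := star_product_row i SX.
  apply: le_trans (dotr_le_norm2 _ u1).
  rewrite row_mulmx dotr_suml (bigD1 i)//= /delta; apply: lerD.
    rewrite dotrZl ler_wpM2l// uX dotrZl.
    have -> : dotr u u = 1.
      rewrite -[RHS]u1 -[in RHS](dotr_normalize u) /normalize u1.
      by rewrite invr1 scale1r.
    by rewrite mulr1; case/andP: (gam_bd i u1).
  rewrite -sumrN; apply: ler_sum => j _; rewrite dotrZl -mulrN ler_wpM2l//.
  by case/andP: (dotr_row_bound j SX u1).
have [->|w0] := eqVneq (row i (A *m X)) 0.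
  have /eqP -> : norm2 (0 : 'rV[R]_d) == 0 by rewrite norm2_eq0.
  by apply: sumr_ge0 => j _; rewrite mulr_ge0// ltW.
rewrite -dotr_normalize [X in dotr X _]row_mulmx dotr_suml; apply: ler_sum => j _.
rewrite dotrZl ler_wpM2l//.
by case/andP: (dotr_row_bound j SX (unit_sphere_normalize w0)).
Qed.

Let row_neq0 X : star_product gam X -> forall i, row i (A *m X) != 0.
Proof.
move=> SX i; have /andP[+ _] := norm2_row_bounds SX i; rewrite -norm2_gt0.
exact: lt_le_trans.
Qed.

Lemma radial_proj_star X : star_product gam X ->
  star_product gam (radial_proj gam (A *m X)).
Proof.
move=> SX i; exists (normalize (row i (A *m X))); last by rewrite rowK.
exact/unit_sphere_normalize/row_neq0.
Qed.

Lemma radial_projE X : radial_proj gam X = scaling_mx gam X *m X.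
Proof. by apply/matrixP => i j; rewrite mul_diag_mx !mxE mulrA. Qed.

Lemma scaling_mulE X i j : (scaling_mx gam (A *m X) *m A) i j =
  gam i (normalize (row i (A *m X))) / norm2 (row i (A *m X)) * A i j.
Proof. by rewrite mul_diag_mx !mxE. Qed.

(** The constants do not depend on [X], so they hold along a whole trajectory. *)
Lemma step_mx_bounds : exists c C : R, 0 < c /\
  forall X, star_product gam X ->
  (forall i j, (i == j) || e i j -> c <= (scaling_mx gam (A *m X) *m A) i j) /\
  (forall i j, 0 <= (scaling_mx gam (A *m X) *m A) i j <= C).
Proof.
have K0 i : 0 < K i.
  rewrite /K (bigD1 i)//=; apply: ltr_pwDl; first exact: mulr_gt0.
  by apply: sumr_ge0 => j _; rewrite mulr_ge0// ltW.
(* Zero entries of [A] are replaced by 1, to have a finite family of positive numbers. *)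
have [c c0 cP] : exists2 c, 0 < c & forall ij : 'I_n * 'I_n,
    c <= if 0 < A ij.1 ij.2 then lo ij.1 / K ij.1 * A ij.1 ij.2 else 1.
  apply: fin_pos_lower_bound => -[i j] /=; case: ifPn => // Aij.
  by rewrite mulr_gt0// divr_gt0.
exists c, (\sum_i \sum_j hi i / delta i * A i j); split=> // X SX.
have scale i : lo i / K i <= gam i (normalize (row i (A *m X))) /
    norm2 (row i (A *m X)) <= hi i / delta i.
  have w0 := row_neq0 SX i.
  have /andP[g1 g2] := gam_bd i (unit_sphere_normalize w0).
  have /andP[h1 h2] := norm2_row_bounds SX i.
  have N0 : 0 < norm2 (row i (A *m X)) by rewrite norm2_gt0.
  apply/andP; split; apply: ler_pM; rewrite ?invr_ge0 ?norm2_ge0 ?(ltW (K0 _)) ?(ltW (lo_gt0 _))//.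
  - by rewrite lef_pV2 ?posrE.
  - exact/ltW/gam_gt0/unit_sphere_normalize.
  - by rewrite lef_pV2 ?posrE.
split=> i j => [ij|]; rewrite scaling_mulE.
  have Aij : 0 < A i j.
    by case/orP: ij => [/eqP <-//|]; case: (wA i j) => + _; apply.
  have := cP (i, j); rewrite /= Aij => /le_trans; apply.
  by rewrite ler_wpM2r//; case/andP: (scale i).
apply/andP; split.
  rewrite mulr_ge0//; case/andP: (scale i) => + _; apply: le_trans.
  by rewrite divr_ge0// ltW.
apply: le_trans (_ : hi i / delta i * A i j <= _).
  by rewrite ler_wpM2r//; case/andP: (scale i).
have t0 i' j' : 0 <= hi i' / delta i' * A i' j' by rewrite mulr_ge0// divr_ge0// ltW.
rewrite (bigD1 i)//= (bigD1 j)//= -addrA lerDl addr_ge0//.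
  by apply: sumr_ge0.
by apply: sumr_ge0 => i' _; apply: sumr_ge0.
Qed.

(* Row dominance of A diag(lo), evaluated at an index maximizing |z_i| / lo_i. *)
Lemma weight_matrix_unitmx : A \in unitmx.
Proof.
rewrite -unitmx_tr -row_free_unit -kermx_eq0; apply/eqP/eqP/rowV0P => z /sub_kermxP zA.
apply/rowP => k0; pose w i := `|z 0 i| / lo i.
have [i _ imax] : exists2 i, true & forall j, w j <= w i.
  case: (@Order.TotalTheory.arg_maxP _ _ _ k0 xpredT w isT) => i _ imax.
  by exists i => // j; exact: imax.
have zw j : `|z 0 j| = w j * lo j by rewrite divfK// gt_eqF.
have eqz : A i i * z 0 i = - \sum_(j | j != i) A i j * z 0 j.
  move/rowP: zA => /(_ i); rewrite !mxE (bigD1 i)//= !mxE.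
  rewrite [X in _ + X](_ : _ = \sum_(j | j != i) A i j * z 0 j); last first.
    by apply: eq_bigr => j _; rewrite mxE mulrC.
  by rewrite mulrC => /eqP; rewrite addr_eq0 => /eqP.
have wi0 : 0 <= w i by rewrite divr_ge0// ltW.
have : w i * (A i i * lo i) <= w i * \sum_(j | j != i) A i j * hi j.
  rewrite mulrCA -zw -[A i i]gtr0_norm// -normrM eqz normrN.
  apply: le_trans (ler_norm_sum _ _ _) _; rewrite mulr_sumr; apply: ler_sum => j _.
  rewrite normrM ger0_norm// mulrCA ler_wpM2l// zw.
  apply: ler_pM => //; [by rewrite divr_ge0// ltW|exact: ltW].
move=> h; have wi : w i = 0.
  apply/eqP; rewrite eq_le wi0 andbT leNgt; apply/negP => wi.
  by move: h; rewrite ler_pM2l// leNgt domA.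
apply/eqP; rewrite mxE -normr_eq0 zw mulf_eq0 eq_le; apply/orP; left.
by rewrite -{1}wi imax divr_ge0// ltW.
Qed.

(** * A single trajectory and its limit direction *)

Section one_trajectory.
Variables (t0 : nat) (X0 : 'M[R]_(n, d)) (X : nat -> 'M[R]_(n, d)).
Hypotheses (SX0 : star_product gam X0) (trX : trajectory gam A t0 X0 X).

Let XS k : X (t0 + k.+1)%N = radial_proj gam (A *m X (t0 + k)%N).
Proof. by rewrite addnS (proj2 trX)// leq_addr. Qed.

Lemma trajectory_star k : star_product gam (X (t0 + k)%N).
Proof.
elim: k => [|k IH]; first by rewrite addn0 (proj1 trX).
by rewrite XS; exact: radial_proj_star.
Qed.

Lemma trajectory_transition k : X (t0 + k)%N = transition_mx gam A t0 X k *m X0.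
Proof.
elim: k => [|k IH]; first by rewrite addn0 (proj1 trX) mul1mx.
by rewrite XS radial_projE /= {2}IH !mulmxA.
Qed.

(** A trajectory started at another time is a time shift, which makes the limit direction
    independent of the starting time. *)
Lemma transition_mx_unique t1 (Y : nat -> 'M[R]_(n, d)) k :
  trajectory gam A t1 X0 Y -> transition_mx gam A t1 Y k = transition_mx gam A t0 X k.
Proof.
move=> [Y0 YS]; elim: k => //= k ->; congr (scaling_mx gam (A *m _) *m _ *m _).
elim: k => [|k IH]; first by rewrite !addn0 Y0 (proj1 trX).
by rewrite XS addnS YS ?leq_addr// IH.
Qed.

Let T k := scaling_mx gam (A *m X (t0 + k)%N) *m A.

Let transition_mxprod k : transition_mx gam A t0 X k = mxprod T 0 k.
Proof. by elim: k => //= k ->; rewrite add0n. Qed.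

(** Positive factors do not change [normalize], so each row may be divided by its sum; the quotients
    converge to a common [L], and [normalize] is continuous at [L != 0]. *)
Lemma transition_row_limit : (0 < n)%N ->
  exists v : 'rV[R]_n, [/\ unit_sphere v, forall j, 0 < v 0 j,
    min_cone A v,
    forall k i, row i (transition_mx gam A t0 X k) != 0
    & forall i, normalize (row i (transition_mx gam A t0 X k)) @[k --> \oo] --> v].
Proof.
move=> n0; pose i0 := Ordinal n0.
have [c [C [c0 cC]]] := step_mx_bounds.
have Tc k : forall i j, (i == j) || e i j -> c <= T k i j.
  by case: (cC _ (trajectory_star k)).
have TC k : forall i j, 0 <= T k i j <= C.
  by case: (cC _ (trajectory_star k)).
have T0 k i j : 0 <= T k i j by case/andP: (TC k i j).
pose y k i := \sum_j mxprod T 0 k i j.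
have y0 k i : 0 < y k i by exact: (row_sum_mxprod_gt0 c0 Tc TC).
have [L [L0 PL]] := row_ratio_cvg c0 Tc TC e_conn i0.
have Ln0 : L != 0.
  by apply/rV0Pn; exists i0; rewrite gt_eqF.
have rowE k i : (y k i)^-1 *: row i (mxprod T 0 k) =
    \row_j (mxprod T 0 k i j / y k i).
  by apply/rowP => j; rewrite !mxE mulrC.
have PLmx i : ((y k i)^-1 *: row i (mxprod T 0 k)) @[k --> \oo] --> L.
  apply: cvg_mxP => i' j; rewrite (ord1 i').
  under eq_fun do rewrite rowE mxE.
  exact: PL.
have row0 k i : row i (mxprod T 0 k) != 0.
  apply/eqP => h; have := y0 k i; rewrite /y big1 ?ltxx// => j _.
  by move/rowP: h => /(_ j); rewrite !mxE.
exists (normalize L); split.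
- exact: unit_sphere_normalize.
- by move=> j; rewrite mxE mulr_gt0// invr_gt0 norm2_gt0.
- (* The cone of A is closed because A is invertible, and every product with
     at least one factor has the form B A with B >= 0. *)
  exists (fun j => (normalize L *m invmx A) 0 j); split; last first.
    rewrite -[LHS](mulmxKV weight_matrix_unitmx).
    by rewrite mulmx_sum_row; apply: eq_bigr.
  move=> j; rewrite -scalemxAl mxE mulr_ge0 ?invr_ge0 ?norm2_ge0//.
  have cvgLA : (((y k.+1 i0)^-1 *: row i0 (mxprod T 0 k.+1)) *m invmx A) 0 j
      @[k --> \oo] --> (L *m invmx A) 0 j.
    apply: cvg_coord; apply: cvg_mulmxr.
    have := PLmx i0; rewrite -(cvg_shiftS (fun k => _ *: _)); exact.
  apply: (@closed_cvg _ _ \oo _ _ (fun x : R => 0 <= x) _ _ _ cvgLA).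
    exact: closed_ge.
  apply: nearW => k; rewrite -scalemxAl mxE mulr_ge0 ?invr_ge0 ?(ltW (y0 _ _))//.
  rewrite -(add1n k) mxprodD /= mulmx1 row_mul /T !mulmxA.
  rewrite mulmxK ?weight_matrix_unitmx// mxE; apply: sumr_ge0 => l _.
  apply: mulr_ge0; first by rewrite mxE mxprod_ge0.
  rewrite !mxE; case: eqP => _; last by rewrite mulr0n.
  rewrite mulr1n divr_ge0 ?norm2_ge0// ltW//; apply: gam_gt0.
  by apply/unit_sphere_normalize/row_neq0/trajectory_star.
- by move=> k i; rewrite transition_mxprod.
move=> i; have := cvg_normalize _ Ln0 (PLmx i).
have -> : (fun k => normalize ((y k i)^-1 *: row i (mxprod T 0 k))) =
    (fun k => normalize (row i (transition_mx gam A t0 X k))).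
  by apply/funext => k; rewrite normalizeZ ?invr_gt0// transition_mxprod.
exact.
Qed.

(** [xget] returns its default only if no candidate exists, and one does; evaluating candidates on
    the given trajectory at one index shows that there is just one. *)
Lemma limit_directionP : (0 < n)%N -> let v := limit_direction gam A X0 in
  [/\ is_limit_direction gam A X0 v, unit_sphere v, forall j, 0 < v 0 j
    & min_cone A v].
Proof.
move=> n0; have [v [v1 vp vA _ vl]] := transition_row_limit n0.
have vdir : is_limit_direction gam A X0 v.
  move=> t1 Y trY i.
  under eq_fun do rewrite (transition_mx_unique _ trY).
  exact: vl.
have : is_limit_direction gam A X0 (limit_direction gam A X0).
  by apply: (@xgetPex _ _ [set v | is_limit_direction gam A X0 v]); exists v.
move=> ldir; suff <- : v = limit_direction gam A X0 by split.
exact: cvg_unique (vdir _ _ trX (Ordinal n0)) (ldir _ _ trX (Ordinal n0)).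
Qed.

Lemma limit_direction_consensus : (0 < n)%N ->
  limit_direction gam A X0 *m X0 != 0 -> direction_consensus X.
Proof.
move=> n0; have [vdir _ _ _] := limit_directionP n0.
set v := limit_direction gam A X0 => vX0.
have [_ [_ _ _ row0 _]] := transition_row_limit n0.
exists (normalize (v *m X0)); split; first exact: unit_sphere_normalize.
move=> i; rewrite -(cvg_shiftn t0).
(* Normalizing the row before multiplying by [X0] leaves the final direction unchanged and gives the
   inner sequence the limit [v]. *)
have -> : (fun k => normalize (row i (X (k + t0)%N))) =
   (fun k => normalize (normalize (row i (transition_mx gam A t0 X k)) *m X0)).
  apply/funext => k; rewrite addnC trajectory_transition row_mul.
  by rewrite /normalize -scalemxAl -/(normalize _) -/(normalize _) normalizeZ// invr_gt0 norm2_gt0.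
by apply: cvg_normalize => //; apply: cvg_mulmxr; exact: vdir.
Qed.

End one_trajectory.
End radial_dynamics.

(** * Rank-deficient configurations *)

Section null_sets.
Context {R : realType}.
Import HBNNSimple.
Local Open Scope ereal_scope.

(* Stated for a bare set function, since surface_measure is not known to be
   sigma-additive: only its values on subsets of N matter. *)
Lemma integral_null_support (dsp : measure_display) (T : measurableType dsp)
    (mu : set T -> \bar R) (f : T -> \bar R) (N : set T) :
  (forall E, E `<=` N -> mu E = 0) -> (forall x, ~ N x -> f x = 0) ->
  \int[mu]_x f x = 0.
Proof.
move=> muN fN; rewrite /integral patch_setT.
(* The integral is a difference of suprema over simple functions, for the positive and the negative
   part of [f]; both parts vanish off [N]. *)
suff nn0 (g : T -> \bar R) : (forall x, ~ N x -> g x = 0) ->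
    (forall x, 0 <= g x) ->
    ereal_sup [set sintegral mu h |
      h in [set h : {nnsfun T >-> R} | forall x, (h x)%:E <= g x]] = 0.
  rewrite !nn0 ?sube0// => x.
  - by move=> /fN fx; rewrite funenegE fx oppe0 maxxx.
  - by move=> /fN fx; rewrite funeposE fx maxxx.
move=> gN g0.
rewrite [X in ereal_sup X](_ : _ = [set 0]) ?ereal_sup1//.
have sint0 (h : {nnsfun T >-> R}) : (forall x, (h x)%:E <= g x) ->
    sintegral mu h = 0.
  (* A nonnegative simple function below [g] takes nonzero values only inside [N]. *)
  move=> hg; rewrite /sintegral fsbig1// => r _.
  have [->|r0] := eqVneq r 0%R; first by rewrite mul0e.
  rewrite muN ?mule0// => x /= hxr.
  apply: contrapT => Nx; have := hg x; rewrite gN// lee_fin => hx0.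
  move/eqP: r0; apply; apply/eqP; rewrite -hxr eq_le hx0/=.
  exact: fun_ge0.
apply/seteqP; split => [_ [h /= hg <-]|_ ->] /=; first exact: sint0.
by exists nnsfun0 => //; exact: sint0.
Qed.

Lemma tuple_measureS (dsp : measure_display) (T : measurableType dsp)
    (mu : set T -> \bar R) m (F : set (m.+1.-tuple T)) :
  tuple_measure mu m.+1 F =
  \int[mu]_x tuple_measure mu m [set t : m.-tuple T | F [tuple of x :: t]].
Proof.
rewrite /= /pushforward /product_measure1; congr (integral _ _ _).
by apply/funext => x /=; rewrite xsectionE.
Qed.

(** Induction by slicing along the first coordinate. If a later coefficient is nonzero, every slice
    lies in a hyperplane; otherwise the slices are empty except at the single point [b / a ord0]. *)
Lemma tuple_measure_hyperplane d (a : 'I_d -> R) (b : R)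
    (F : set (d.-tuple R)) :
  (exists j, a j != 0%R) ->
  F `<=` [set t | \sum_j (a j * tnth t j) = b]%R ->
  lebesgue_measure_d F = 0.
Proof.
rewrite /lebesgue_measure_d; elim: d a b F => [|d IH] a b F [j aj] Fab.
  by case: j aj.
rewrite tuple_measureS.
have Fab' x : [set t : d.-tuple R | F [tuple of x :: t]] `<=`
    [set t | \sum_j (a (lift ord0 j) * tnth t j) = b - a ord0 * x]%R.
  move=> t /= /Fab /=; rewrite big_ord_recl /= tnth0 => <-.
  rewrite [X in (X - _)%R]addrC addrK; apply: eq_bigr => k _; by rewrite tnthS.
have [[k ak]|na] := pselect (exists k, a (lift ord0 k) != 0%R).
  apply: (@integral_null_support _ _ _ _ set0) => [E|x _].
    by rewrite subset0 => ->; exact: measure0.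
  by apply: IH (Fab' x); exists k.
have a'0 k : a (lift ord0 k) = 0%R.
  by apply/eqP/negPn/negP => ak; apply: na; exists k.
have a0 : a ord0 != 0%R.
  by case: (unliftP ord0 j) aj => [k|] ->//; rewrite a'0 eqxx.
apply: (@integral_null_support _ _ _ _ [set (b / a ord0)%R]) => [E Eb|x xb].
  apply: countable_lebesgue_measure0.
  exact: sub_countable (subset_card_le Eb) (countable1 _).
rewrite (_ : [set t | _] = set0); last first.
  rewrite -subset0 => t /Fab' /=; rewrite big1 => [|k _]; last by rewrite a'0 mul0r.
  by move=> /esym/eqP; rewrite subr_eq0 => /eqP h; apply: xb; rewrite /= h mulrC mulKf.
(* The empty set has value 0, by induction on the number of coordinates. *)
elim: {+}d => [|m IHm]; first by rewrite /= dirac0.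
rewrite tuple_measureS; apply: (@integral_null_support _ _ _ _ set0) => //.
by move=> E; rewrite subset0 => ->; exact: measure0.
Qed.

Lemma surface_measure_subspace d p (W : 'M[R]_(p, d)) (E : set (d.-tuple R)) :
  (\rank W < d)%N -> E `<=` [set t | (row_of t <= W)%MS] ->
  surface_measure E = 0.
Proof.
move=> Wd EW; rewrite /surface_measure.
(* [a] is a nonzero vector orthogonal to [W], taken from the column space of its cokernel. *)
have /rowV0Pn[a aC a0] : (cokermx W)^T != 0%R.
  by rewrite -mxrank_eq0 mxrank_tr mxrank_coker subn_eq0 -ltnNge.
have Wa (u : 'rV[R]_d) : (u <= W)%MS -> (\sum_j a 0 j * u 0 j = 0)%R.
  move=> uW; have : (u *m a^T = 0)%R.
    have /submxP[D ->] := aC.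
    rewrite trmx_mul trmxK mulmxA.
    by move: uW; rewrite submxE => /eqP ->; rewrite mul0mx.
  move=> /matrixP /(_ 0%R 0%R); rewrite !mxE; apply: etrans.
  by apply: eq_bigr => j _; rewrite !mxE mulrC.
rewrite (_ : lebesgue_measure_d _ = 0) ?mule0//.
apply: (@tuple_measure_hyperplane _ (a 0%R) 0%R); first exact/rV0Pn.
move=> t [u [r [Eu _ _ tu]]] /=.
transitivity (\sum_j a 0 j * (row_of t) 0 j)%R.
  by apply: eq_bigr => j _; rewrite mxE.
by rewrite tu; apply: Wa; apply: scalemx_sub; exact: EW.
Qed.

Definition rows_of m d (U : m.-tuple (d.-tuple R)) : 'M[R]_(m, d) :=
  \matrix_i row_of (tnth U i).

(* Induction on m with W fixed in advance: the first vector u falls into the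
   null set W, or else W + u takes over the role of W. *)
Lemma tuple_measure_rank_lt d m (W : 'M[R]_d) (F : set (m.-tuple (d.-tuple R))) :
  (\rank W + m <= d)%N ->
  F `<=` [set U | (\rank (W + rows_of U)%MS < \rank W + m)%N] ->
  tuple_measure (@surface_measure R d) m F = 0.
Proof.
elim: m W F => [|m IH] W F Wm FW.
  (* With no vector to add, the rank cannot drop, so [F] is empty. *)
  rewrite (_ : F = set0) ?[LHS]dirac0//; rewrite -subset0 => U /FW /=.
  by rewrite addn0 ltnNge mxrankS// addsmxSl.
rewrite tuple_measureS.
apply: (@integral_null_support _ _ _ _ [set u | (row_of u <= W)%MS]) => [E EW|u].
  by apply: surface_measure_subspace EW; apply: leq_trans Wm; rewrite -addSnnS leq_addr.
move=> /negP uW; set W' := (W + row_of u)%MS.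
have W'r : (\rank W < \rank W')%N.
  apply: rank_ltmx; rewrite /ltmx addsmxSl/=; apply: contra uW.
  exact: submx_trans (addsmxSr _ _).
apply: (IH W').
  apply: leq_trans Wm; rewrite -addSnnS leq_add2r -addn1.
  apply: leq_trans (mxrank_adds_leqif _ _) _.
  by rewrite leq_add2l rank_leq_row.
(* The span of [W'] and [U] lies in that of [W] and [u :: U], while [\rank W'] exceeds [\rank W]; so
   the rank deficiency is inherited by [W'] and [U]. *)
move=> U /FW /= h; apply: leq_trans (_ : _ <= \rank W + m.+1)%N _.
  apply: leq_ltn_trans h; apply: mxrankS.
  have sub i : (row_of (tnth [tuple of u :: U] i) <=
      rows_of [tuple of u :: U])%MS.
    by rewrite -[row_of _](rowK (fun i => row_of (tnth [tuple of u :: U] i))) row_sub.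
  rewrite addsmx_sub; apply/andP; split; first rewrite addsmx_sub addsmxSl.
    by apply: submx_trans (addsmxSr _ _); have := sub ord0; rewrite tnth0.
  apply: submx_trans (addsmxSr _ _); apply/row_subP => i; rewrite rowK.
  by have := sub (lift ord0 i); rewrite tnthS.
by rewrite -addSnnS leq_add2r.
Qed.

(** If [x M M^T = 0], the squares of the entries of [x M] sum to 0, so [x M = 0]. Rank deficiency
    thus becomes one polynomial equation. *)
Lemma gram_unitmx m d (M : 'M[R]_(m, d)) :
  (M *m M^T \in unitmx) = row_free M.
Proof.
rewrite -row_free_unit -!kermx_eq0.
suff -> : (kermx (M *m M^T) == 0)%R = (kermx M == 0)%R by [].
apply/eqP/eqP => K0; apply/eqP/rowV0P => x /sub_kermxP xK.
  by apply/eqP; rewrite -submx0 -K0; apply/sub_kermxP; rewrite mulmxA xK mul0mx.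
apply/eqP; rewrite -submx0 -K0; apply/sub_kermxP.
have : ((x *m M) *m (x *m M)^T = 0)%R.
  by rewrite trmx_mul mulmxA -[(x *m M *m _)%R]mulmxA xK mul0mx.
move=> /matrixP /(_ 0%R 0%R); rewrite !mxE => /eqP.
rewrite psumr_eq0 => [/allP h|j _]; last by rewrite !mxE -expr2 sqr_ge0.
apply/rowP => j; have := h j (mem_index_enum _).
by rewrite !mxE mulf_eq0 orbb => /eqP.
Qed.

(** Negligibility asks for a measurable null superset; the Leibniz expansion shows the determinant
    to be a polynomial in the coordinates. *)
Lemma measurable_rank_deficient m d :
  measurable [set U : m.-tuple (d.-tuple R) | \det (rows_of U *m (rows_of U)^T) = 0%R].
Proof.
have mdet : measurable_fun [set: m.-tuple (d.-tuple R)]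
    (fun U => \det (rows_of U *m (rows_of U)^T)).
  rewrite (_ : (fun U => _) = fun U => (\sum_(s : 'S_m) (-1) ^+ (s : bool) *
      \prod_i \sum_j (tnth (tnth U i) j * tnth (tnth U (s i)) j))%R); last first.
    apply/funext => U; apply: eq_bigr => s _; congr (_ * _)%R.
    by apply: eq_bigr => i _; rewrite mxE; apply: eq_bigr => j _; rewrite !mxE.
  apply: measurable_sum => s; apply: measurable_funM; first exact: measurable_cst.
  apply: measurable_prod => i _; apply: measurable_sum => j.
  apply: measurable_funM.
  - exact: (measurableT_comp (measurable_tnth j) (measurable_tnth i)).
  - exact: (measurableT_comp (measurable_tnth j) (measurable_tnth (s i))).
rewrite -[X in measurable X]setTI.
exact: (mdet measurableT [set 0%R] (measurable_set1 _)).
Qed.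

Lemma star_null_rank_deficient n d (gam : 'I_n -> 'rV[R]_d -> R) :
  (forall i u, unit_sphere u -> (gam i u != 0)%R) -> (n <= d)%N ->
  star_null gam [set X | star_product gam X /\ \rank X <> n].
Proof.
move=> gam0 nd.
exists [set U | \det (rows_of U *m (rows_of U)^T) = 0%R].
split; first exact: measurable_rank_deficient.
  apply: (@tuple_measure_rank_lt _ _ 0%R); first by rewrite mxrank0.
  move=> U /= dU; rewrite mxrank0 add0n adds0mx.
  have : ~~ row_free (rows_of U) by rewrite -gram_unitmx unitmxE dU unitr0.
  by rewrite ltn_neqAle rank_leq_row andbT.
move=> U [Uu [_ rU]] /=; apply/eqP/negPn/negP => dU; apply: rU.
have : row_free (rows_of U) by rewrite -gram_unitmx unitmxE unitfE.
(* Nonzero radii form an invertible diagonal matrix, so full rank of the directions gives full rank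
   of the configuration. *)
have -> : star_point gam U =
    (diag_mx (\row_i gam i (row_of (tnth U i))) *m rows_of U)%R.
  by apply/matrixP => i j; rewrite mul_diag_mx !mxE.
move=> /eqP rU; rewrite eqmxMfull// row_full_unit unitmxE det_diag unitfE.
by apply/prodf_neq0 => i _; rewrite mxE; apply: gam0; exact: Uu.
Qed.
End null_sets.

(** * Bounds of directional functions, and the three conditions *)

Lemma sphere_extrema (R : realType) (d : nat) (g : 'rV[R]_d -> R) :
  (1 <= d)%N -> directional g ->
  0 < sphere_min g /\
  forall u, unit_sphere u -> sphere_min g <= g u <= sphere_max g.
Proof.
move=> d0 [_ [m [M [m0 mM]]]].
have [w w1] := unit_sphere_nonempty (R := R) d0.
have lb : lbound (g @` @unit_sphere R d) m.
  by move=> _ [u u1 <-]; case/andP: (mM u u1).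
have ub : ubound (g @` @unit_sphere R d) M.
  by move=> _ [u u1 <-]; case/andP: (mM u u1).
split.
  by apply: lt_le_trans m0 _; apply: lb_le_inf => //; exists (g w), w.
move=> u u1; apply/andP; split.
  by apply: ge_inf; [exists m|exists u].
by apply: ub_le_sup; [exists M|exists u].
Qed.

Theorem corollary2 (R : realType) (n d : nat) (hn : (1 <= n)%N) (hd : (1 <= d)%N)
  (gam : 'I_n -> 'rV[R]_d -> R) (hgam : forall i, directional (gam i))
  (e : rel 'I_n) (he : strongly_connected e)
  (A : 'M[R]_n) (hA : nonneg_weight_matrix e A)
  (hdom : forall i,
     \sum_(j | j != i) A i j * sphere_max (gam j) < A i i * sphere_min (gam i)) :
  (forall (t0 : nat) (X0 : 'M[R]_(n, d)) (X : nat -> 'M[R]_(n, d)),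
     star_product gam X0 ->
     trajectory gam A t0 X0 X ->
     let v := limit_direction gam A X0 in
     [/\ is_limit_direction gam A X0 v, unit_sphere v & forall j, 0 < v 0 j] /\
     (   (exists h : 'rV[R]_d,
            [/\ unit_sphere h, forall i, 0 <= (X0 *m h^T) i 0
              & X0 *m h^T <> 0])
      \/ \rank X0 = n
      \/ (exists j : 'I_d,
            col j X0 <> 0 /\ ~ min_cone_perp A (col j X0)^T)
      -> v *m X0 <> 0 /\ direction_consensus X))
  /\ ((n <= d)%N ->
      star_null gam [set X0 | star_product gam X0 /\ \rank X0 <> n]).
Proof.
have lo0 i : 0 < sphere_min (gam i) by case: (sphere_extrema hd (hgam i)).
have gbd i : forall u, unit_sphere u ->
    sphere_min (gam i) <= gam i u <= sphere_max (gam i).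
  by case: (sphere_extrema hd (hgam i)).
split; last first.
  apply: star_null_rank_deficient => i u /(gbd i) /andP[gu _].
  by rewrite gt_eqF// (lt_le_trans (lo0 i)).
move=> t0 X0 X SX trX v.
have [vdir v1 vp vA] := limit_directionP hd lo0 gbd hA hdom he SX trX hn.
split=> // cond; suff vX : v *m X0 <> 0.
  split=> //; apply: (limit_direction_consensus hd lo0 gbd hA hdom he SX trX hn).
  exact/eqP.
move=> vX; case: cond => [[h [_ Xh0 Xh]]|[rX|[j [_]]]].
(* [v (X0 h^T) = 0] is a vanishing sum of nonnegative terms with positive weights [v 0 i], so every
   entry of [X0 h^T] is 0. *)
- apply: Xh; apply/colP => i; rewrite [RHS]mxE; apply/eqP.
  have /matrixP /(_ 0 0) : v *m (X0 *m h^T) = 0 by rewrite mulmxA vX mul0mx.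
  rewrite [LHS]mxE [RHS]mxE => /eqP; rewrite psumr_eq0 => [/allP /(_ i (mem_index_enum _))|k _].
    by rewrite mulf_eq0 gt_eqF.
  by rewrite mulr_ge0// ltW.
(* Right multiplication by [X0] is injective, so [v] would be 0. *)
- have /negP := unit_sphere_neq0 v1; apply.
  have /row_free_inj inj : row_free X0 by rewrite /row_free rX.
  by apply/eqP/inj; rewrite mul0mx.
(* [v] itself is the nonzero cone element orthogonal to the column. *)
- apply; exists v; split=> //; first exact/eqP/unit_sphere_neq0.
  by rewrite trmxK colE mulmxA vX mul0mx.
Qed.
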